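(* Let $\mathcal{P}$ be a convex family of probability distributions over $\mathcal{Z}$ and let $D$ be a discrepancy function on $\mathcal{P}$. If $D$ is coherent, then $D$ is A-coherent; that is, for every random distribution $\tilde P$ over $\mathcal{P}$, $E\{D(\tilde P,Q)\}$ is minimised over $Q\in\mathcal{P}$ when $Q=E(\tilde P)$.
   Context: $\mathcal{P}$ is convex in the sense that $E(\tilde P)\in\mathcal{P}$ for every random element $\tilde P$ of $\mathcal{P}$ (where $E(\tilde P)$ is the mixture distribution). A discrepancy function on $\mathcal{P}$ is a function $D$ on $\mathcal{P}\times\mathcal{P}$ with $D(P,Q)\ge0$ and $D(P,P)=0$ for all $P,Q\in\mathcal{P}$. It is coherent if it arises from a decision problem, that is, if $D(P,Q)=L\{P,a(Q)\}-L\{P,a(P)\}$ for some action space $\mathcal{A}$ and loss function $L(z,a)$ with domain $\mathcal{P}$; equivalently, if $D(P,Q)=S(P,Q)-S(P,P)$ for some proper scoring rule $S$ over $\mathcal{P}$. Here $L(P,a):=E_P\{L(Z,a)\}$, and $L$ has domain $\mathcal{P}$ if $L(P,a)$ exists (possibly infinite) for all $P\in\mathcal{P}$, $a\in\mathcal{A}$, and for each $P\in\mathcal{P}$ the infimum $\inf_aL(P,a)$ is finite and attained at a (chosen) Bayes act $a(P)$. A scoring rule $S(z,Q)$ ($z\in\mathcal{Z}$, $Q\in\mathcal{P}$), with $S(P,Q):=E_P\{S(Z,Q)\}$, is proper over $\mathcal{P}$ if $S(P,P)$ is finite and $S(P,P)\le S(P,Q)$ for all $P,Q\in\mathcal{P}$.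 *)

(* Defs.v *)
From mathcomp Require Import all_boot all_order all_algebra.
From mathcomp Require Import all_classical all_reals all_analysis.
From mathcomp Require Import measurable_realfun.

Set Implicit Arguments.
Unset Strict Implicit.
Unset Printing Implicit Defensive.

Import Order.TTheory GRing.Theory Num.Theory.
Local Open Scope classical_set_scope.
Local Open Scope ereal_scope.

(* A random distribution over a family F is a measurable map from a probability
   space to [pprobability Z R] (the probabilities on Z with the sigma-algebra
   generated by the evaluations P |-> P A, A measurable) with values in F. *)
Definition random_distribution (d : measure_display) (Z : measurableType d)
    (R : realType) (F : set (probability Z R)) (d' : measure_display)
    (Omega : measurableType d') (Pt : Omega -> pprobability Z R) : Prop :=
  measurable_fun setT Pt /\ forall w, F (Pt w).

(* [mixture_of mu Pt M] says that M = E(Pt).  It is a relation because two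
   distinct inhabitants of [probability Z R] may agree on all the measurable
   sets, and hence represent the same distribution. *)
Definition mixture_of (d : measure_display) (Z : measurableType d)
    (R : realType) (d' : measure_display) (Omega : measurableType d')
    (mu : probability Omega R) (Pt : Omega -> pprobability Z R)
    (M : probability Z R) : Prop :=
  forall A : set Z, measurable A ->
    M A = \int[mu]_w (Pt w : probability Z R) A.

Definition convex_family (d : measure_display) (Z : measurableType d)
    (R : realType) (F : set (probability Z R)) : Prop :=
  forall (d' : measure_display) (Omega : measurableType d')
    (mu : probability Omega R) (Pt : Omega -> pprobability Z R),
    random_distribution F Pt -> exists2 M, F M & mixture_of mu Pt M.

Definition discrepancy (d : measure_display) (Z : measurableType d)
    (R : realType) (F : set (probability Z R))
    (D : probability Z R -> probability Z R -> \bar R) : Prop :=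
  (forall P Q, F P -> F Q -> 0 <= D P Q) /\ (forall P, F P -> D P P = 0).

Definition expectation_exists (d : measure_display) (Z : measurableType d)
    (R : realType) (P : probability Z R) (f : Z -> \bar R) : Prop :=
  measurable_fun setT f /\
  (\int[P]_z f^\+ z < +oo \/ \int[P]_z f^\- z < +oo).

Definition expected_loss (d : measure_display) (Z : measurableType d)
    (R : realType) (A : Type) (L : Z -> A -> \bar R)
    (P : probability Z R) (a : A) : \bar R :=
  \int[P]_z L z a.

(* The loss function L has domain F, and [bayes P] is the chosen Bayes act
   for each P in F; values of [bayes] outside F are irrelevant. *)
Definition loss_domain (d : measure_display) (Z : measurableType d)
    (R : realType) (F : set (probability Z R)) (A : Type)
    (L : Z -> A -> \bar R) (bayes : probability Z R -> A) : Prop :=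
  (forall P a, F P -> expectation_exists P (L ^~ a)) /\
  (forall P, F P ->
     ereal_inf (range (expected_loss L P)) \is a fin_num /\
     expected_loss L P (bayes P) = ereal_inf (range (expected_loss L P))).

Definition coherent (d : measure_display) (Z : measurableType d)
    (R : realType) (F : set (probability Z R))
    (D : probability Z R -> probability Z R -> \bar R) : Prop :=
  exists (A : Type) (L : Z -> A -> \bar R) (bayes : probability Z R -> A),
    loss_domain F L bayes /\
    forall P Q, F P -> F Q ->
      D P Q = expected_loss L P (bayes Q) - expected_loss L P (bayes P).

(* For D >= 0 the integral below is the usual expectation whenever
   w |-> D (Pt w) Q is measurable, and the lower integral otherwise. *)
Definition A_coherent (d : measure_display) (Z : measurableType d)
    (R : realType) (F : set (probability Z R))
    (D : probability Z R -> probability Z R -> \bar R) : Prop :=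
  forall (d' : measure_display) (Omega : measurableType d')
    (mu : probability Omega R) (Pt : Omega -> pprobability Z R)
    (M : probability Z R),
    random_distribution F Pt -> F M -> mixture_of mu Pt M ->
    forall Q, F Q -> \int[mu]_w D (Pt w) M <= \int[mu]_w D (Pt w) Q.

(* Main.v *)
Require Import Defs.
From mathcomp Require Import all_boot all_order all_algebra.
From mathcomp Require Import all_classical all_reals all_analysis.
From mathcomp Require Import measurable_realfun lra.

(** Let [D] come from a loss [L] with Bayes acts [a(P)], and let [M] be the mean
of the random distribution [Pt].  Then

  [D (Pt w) Q = L (Pt w, a(Q)) - L (Pt w, a(Pt w))],

and only the first term depends on [Q].  Since a mixture integrates losses
linearly ([integral_mixture]), the mean of [L (Pt w, a(Q))] is [L (M, a(Q))],
which is smallest at [Q = M] because [a(M)] is a Bayes act against [M].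

Two points need care.  The term common to all [Q], the Bayes risk
[L (Pt w, a(Pt w))], is an infimum over arbitrarily many acts: it need not be
measurable in [w], so [w |-> D (Pt w) Q] need not be either, and the integrals
compared are lower integrals, for which additivity may fail.  Also
[L (Pt w, a(Q))] may be infinite, so that differences cannot be formed freely.
Both are met by [lower_integral_exchange]: from [f + p <= g + q] with [p] and
[q] measurable, [\int q <= \int p] and [\int q] finite, it infers
[\int f <= \int g] between the lower integrals of arbitrary nonnegative [f] and
[g].  It is applied to [f = D (Pt w) M] and [g = D (Pt w) Q], with [p] and [q] built from
the positive and negative parts of the losses of [a(M)] and [a(Q)], so that
every integral taken is that of a nonnegative function. *)

Set Implicit Arguments.
Unset Strict Implicit.
Unset Printing Implicit Defensive.

Import Order.TTheory GRing.Theory Num.Theory.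
Import HBNNSimple.
Local Open Scope classical_set_scope.
Local Open Scope ring_scope.
Local Open Scope ereal_scope.

(** The integral of an arbitrary nonnegative function is the supremum of the
integrals of the simple functions below it, and this is monotone. *)
Lemma ge0_le_lower_integral (d : measure_display) (T : measurableType d)
    (R : realType) (mu : {measure set T -> \bar R}) (f g : T -> \bar R) :
  (forall x, 0 <= f x) -> (forall x, f x <= g x) ->
  \int[mu]_x f x <= \int[mu]_x g x.
Proof.
move=> f0 fg; have g0 x : 0 <= g x by exact: le_trans (fg x).
rewrite !ge0_integralTE//; apply: ereal_sup_le => _ [h hf <-].
by exists h => // x; exact: le_trans (hf x) (fg x).
Qed.

(** For a simple [h <= f], the function [max 0 (h + p - q)] is measurable and
lies below [g], and adding [q] back to it gives at least [h + p]. Thus the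
inequality [\int h <= \int g] reduces to additivity for measurable functions. *)
Lemma lower_integral_exchange (d : measure_display) (T : measurableType d)
    (R : realType) (mu : {measure set T -> \bar R}) (f g p q : T -> \bar R) :
  (forall x, 0 <= f x) -> (forall x, 0 <= g x) ->
  (forall x, 0 <= p x) -> (forall x, 0 <= q x) ->
  measurable_fun setT p -> measurable_fun setT q ->
  (forall x, f x + p x <= g x + q x) ->
  \int[mu]_x q x <= \int[mu]_x p x -> \int[mu]_x q x < +oo ->
  \int[mu]_x f x <= \int[mu]_x g x.
Proof.
move=> f0 g0 p0 q0 mp mq fpgq qp qoo.
rewrite ge0_integralTE//; apply: ge_ereal_sup => _ [h hf <-].
have h0 x : 0 <= (h x)%:E by rewrite lee_fin.
have mh : measurable_fun setT (EFin \o h) by exact/measurable_EFinP.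
(* Where [q x = +oo] the convention [+oo - oo = -oo] makes [k x] vanish, so
   that [k x <= g x] holds there as well. *)
pose k x : \bar R := maxe 0 ((h x)%:E + p x - q x).
have k0 x : 0 <= k x by rewrite le_max lexx.
have mk : measurable_fun setT k.
  apply: measurable_maxe => //.
  by apply: emeasurable_funB => //; exact: emeasurable_funD.
have kg x : k x <= g x.
  rewrite /k ge_max g0 /=; have [->|qx] := eqVneq (q x) +oo.
    by rewrite addeNy leNye.
  rewrite leeBlDr; last by rewrite ge0_fin_numE// ltey.
  exact: le_trans (leeD2r _ (hf x)) (fpgq x).
have hpkq x : (h x)%:E + p x <= k x + q x.
  have [->|qx] := eqVneq (q x) +oo.
    by rewrite addey ?leey// -ltNye (lt_le_trans _ (k0 x)).
  have qfin : q x \is a fin_num by rewrite ge0_fin_numE// ltey.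
  by rewrite -leeBlDr// /k le_max lexx orbT.
rewrite -(integralT_nnsfun mu h).
apply: le_trans (ge0_le_lower_integral mu k0 kg).
have qfin : \int[mu]_x q x \is a fin_num.
  by rewrite ge0_fin_numE//; exact: integral_ge0.
rewrite -(leeD2rE _ _ qfin); apply: le_trans (leeD2l _ qp) _.
rewrite -!ge0_integralD//; apply: ge0_le_lower_integral => // x.
exact: adde_ge0.
Qed.

Section mixture.
Context (d : measure_display) (Z : measurableType d) (R : realType)
  (d' : measure_display) (Omega : measurableType d').
Variable (Pt : Omega -> pprobability Z R).
Hypothesis mPt : measurable_fun setT Pt.

(** A random distribution is a probability kernel from [Omega] to [Z], whence
the measurability of the integrals of a fixed nonnegative function. *)
Lemma measurable_integral_random_distribution (f : Z -> \bar R) :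
  (forall z, 0 <= f z) -> measurable_fun setT f ->
  measurable_fun setT (fun w => \int[Pt w]_z f z).
Proof.
move=> f0 mf.
apply: (@measurable_fun_integral_kernel _ _ _ _ _ (kprobability mPt)) => // U mU.
exact: (measurable_kernel (kprobability mPt)).
Qed.

(** The mixture agrees on measurable sets with the composition of [mu], seen as
a kernel from a point, with the kernel [Pt]; the formula is the integration
rule for composite kernels. *)
Lemma integral_mixture (mu : probability Omega R) (M : probability Z R)
    (f : Z -> \bar R) :
  mixture_of mu Pt M -> (forall z, 0 <= f z) -> measurable_fun setT f ->
  \int[M]_z f z = \int[mu]_w \int[Pt w]_z f z.
Proof.
move=> MP f0 mf.
pose l : unit -> pprobability Omega R := cst mu.
have ml : measurable_fun setT l by exact: measurable_cst.
have mk : measurable_fun setT (Pt \o @snd unit Omega).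
  by apply: measurableT_comp => //; exact: measurable_snd.
rewrite -(integral_kcomp (kprobability ml) (kprobability mk) tt f0 mf).
by apply: eq_measure_integral => A mA _; exact: MP.
Qed.

End mixture.

(** With the convention [+oo - oo = -oo], an infinite negative part forces the
integral to be [-oo]. *)
Lemma integral_funeneg_ltoo (d : measure_display) (Z : measurableType d)
    (R : realType) (P : probability Z R) (f : Z -> \bar R) :
  expectation_exists P f -> -oo < \int[P]_z f z -> \int[P]_z f^\- z < +oo.
Proof.
move=> [mf [fp|//]]; rewrite integralE.
rewrite !ltey; apply: contraTneq => ->.
by rewrite addeNy ltxx.
Qed.

Theorem theorem11p1 (d : measure_display) (Z : measurableType d)
    (R : realType) (F : set (probability Z R))
    (D : probability Z R -> probability Z R -> \bar R)
    (convexF : convex_family F) (discrepancyD : discrepancy F D)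
    (coherentD : coherent F D) :
  A_coherent F D.
Proof.
case: coherentD => A [L [bayes [[Lex Linf] DE]]].
case: discrepancyD => D0 _ d' Omega mu Pt M [mPt FPt] FM MPt Q FQ.
have bayes_le P a : F P -> expected_loss L P (bayes P) <= expected_loss L P a.
  by move=> /Linf[_ ->]; apply: ereal_inf_lbound; exists a.
have bayes_fin P : F P -> expected_loss L P (bayes P) \is a fin_num.
  by move=> /Linf[? ->].
have lossNy P a : F P -> -oo < expected_loss L P a.
  move=> FP; apply: lt_le_trans (bayes_le _ a FP).
  by rewrite ltNye_eq bayes_fin.
pose u a (P : probability Z R) : \bar R := \int[P]_z (L ^~ a)^\+ z.
pose v a (P : probability Z R) : \bar R := \int[P]_z (L ^~ a)^\- z.
have lossE P a : expected_loss L P a = u a P - v a P by exact: integralE.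
have u0 a P : 0 <= u a P by apply: integral_ge0.
have v0 a P : 0 <= v a P by apply: integral_ge0.
have v_fin a P : F P -> v a P \is a fin_num.
  move=> FP; rewrite ge0_fin_numE//.
  by apply: integral_funeneg_ltoo; [exact: Lex|exact: lossNy].
have mL a : measurable_fun setT (L ^~ a) by have [] := Lex M a FM.
have mu' a : measurable_fun setT (fun w => u a (Pt w)).
  apply: measurable_integral_random_distribution => //.
  exact: measurable_funepos.
have mv a : measurable_fun setT (fun w => v a (Pt w)).
  apply: measurable_integral_random_distribution => //.
  exact: measurable_funeneg.
have uM a : \int[mu]_w u a (Pt w) = u a M.
  by rewrite /u (integral_mixture mPt MPt)//; exact: measurable_funepos.
have vM a : \int[mu]_w v a (Pt w) = v a M.
  by rewrite /v (integral_mixture mPt MPt)//; exact: measurable_funeneg.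
have uM_fin : u (bayes M) M \is a fin_num.
  have := bayes_fin M FM; rewrite lossE.
  by rewrite fin_numB => /andP[].
have uvM a b : \int[mu]_w (u a (Pt w) + v b (Pt w)) = u a M + v b M.
  by rewrite -uM -vM; apply: ge0_integralD.
(* The inequality [\int q <= \int p] below is
   [u a M - v a M <= u b M - v b M], the optimality of [a] against [M],
   rearranged as a comparison of sums. *)
set a := bayes M; set b := bayes Q.
apply: (@lower_integral_exchange _ _ _ mu _ _
  (fun w => u b (Pt w) + v a (Pt w)) (fun w => u a (Pt w) + v b (Pt w))).
- by move=> w; exact: D0.
- by move=> w; exact: D0.
- by move=> w; exact: adde_ge0.
- by move=> w; exact: adde_ge0.
- exact: emeasurable_funD.
- exact: emeasurable_funD.
- move=> w; rewrite !DE// !lossE -/a -/b.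
  (* With [h] the Bayes risk, which is finite, the claim is
     [(ua - va - h) + (ub + va) <= (ub - vb - h) + (ua + vb)]: an equality
     when all is finite, and clear when [ua] or [ub] is infinite. *)
  have := bayes_fin _ (FPt w); rewrite lossE.
  move: (v_fin a _ (FPt w)) (v_fin b _ (FPt w)).
  move: (u _ _ - v (bayes (Pt w)) _) => h.
  move: (u0 a (Pt w)) (u0 b (Pt w)).
  case: (u a _) => [ua| |]; case: (u b _) => [ub| |] //;
  case: (v a _) => [va| |] //; case: (v b _) => [vb| |] //;
  case: h => [h| |] //= *.
  by rewrite lee_fin; lra.
- rewrite !uvM.
  have := bayes_le M b FM; rewrite !lossE -/a.
  by rewrite leeBlDr ?v_fin// addeAC leeBrDr ?v_fin.
- by rewrite uvM ltey_eq fin_numD uM_fin v_fin.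
Qed.
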